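(* Let $\mathcal{M}_1=(S_1,T_1,P_1,\Phi_1)$ and $\mathcal{M}_2=(S_2,T_2,P_2,\Phi_2)$ be finite PMTS over an action alphabet $\Sigma$ with $P_1,P_2$ disjoint from each other and from all other atoms, and let $s\in S_1$, $t\in S_2$. Let $X_R=S_1\times S_2$, $X_{T1}=T_1$, $X_{T2}=S_1\times T_2$ (elements of $X_{T2}$ written $(u,v,a,v')$ with $u\in S_1$, $(v,a,v')\in T_2$), and $Ap=X_R\uplus X_{T1}\uplus X_{T2}\uplus P_1\uplus P_2$. For $u\in S_1$ let $\pi_u$ map formulas of $\mathcal B((\Sigma\times S_1)\cup P_1)$ to $\mathcal B(Ap)$ by replacing each atom $(a,x)$ with $(u,a,x)$ and leaving parameters unchanged; for $u\in S_1,v\in S_2$ let $\pi_{u,v}$ map $\mathcal B((\Sigma\times S_2)\cup P_2)$ to $\mathcal B(Ap)$ by replacing each atom $(a,x)$ with $(u,v,a,x)$ and leaving parameters unchanged. Define $$\varphi_{u,v}=\bigwedge_{u^*=(u,a,u')\in X_{T1}}\Big(u^*\Rightarrow\bigvee_{v^*=(u,v,a,v')\in X_{T2}}\big(v^*\wedge (u',v')\big)\Big)\ \wedge\ \bigwedge_{v^*=(u,v,a,v')\in X_{T2}}\Big(v^*\Rightarrow\bigvee_{u^*=(u,a,u')\in X_{T1}}\big(u^*\wedge (u',v')\big)\Big)$$ (with the same action $a$ in inner and outer positions), $\psi_{u,v}=\pi_u(\Phi_1(u))\Rightarrow\big(\pi_{u,v}(\Phi_2(v))\wedge\varphi_{u,v}\big)$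 and $\Psi_{s,t}=(s,t)\wedge\bigwedge_{(u,v)\in X_R}((u,v)\Rightarrow\psi_{u,v})$. Then $s\le_m t$ if and only if the quantified Boolean formula $\forall P_1\,\exists P_2\,\exists X_R\,\forall X_{T1}\,\exists X_{T2}\,\Psi_{s,t}$ is true.
   Context: Boolean formulae over a set $X$ of atoms: $\varphi::=\mathbf{tt}\mid x\mid\neg\varphi\mid\varphi\wedge\varphi\mid\varphi\vee\varphi$; $\mathcal B(X)$ is the set of them; a valuation $\nu\subseteq X$ satisfies formulas in the standard way; $\mathbf{ff}$ denotes $\neg\mathbf{tt}$. A PMTS (parametric modal transition system) over $\Sigma$ is a tuple $(S,T,P,\Phi)$ with $S$ a set of states, $T\subseteq S\times\Sigma\times S$, $P$ a finite set of parameters and $\Phi:S\to\mathcal B((\Sigma\times S)\cup P)$ such that whenever $(a,t)$ occurs in $\Phi(s)$ then $(s,a,t)\in T$. A BMTS is a PMTS with $P=\emptyset$. For a state $s$, $T(s)=\{(a,t)\mid(s,a,t)\in T\}$ and, for a BMTS, $\mathrm{Tran}(s)=\{E\subseteq T(s)\mid E\models\Phi(s)\}$. For a PMTS $\mathcal M$ and $\nu\subseteq P$, $\mathcal M^\nu$ is the BMTS $(S,T,\emptyset,\Phi')$ where $\Phi'(s)$ is $\Phi(s)$ with every $p\in\nu$ replaced by $\mathbf{tt}$ and every $p\notin\nu$ by $\mathbf{ff}$; $s^\nu$ is the state $s$ in $\mathcal M^\nu$. Modal refinement of BMTS states: $s_0\le_m t_0$ iff $(s_0,t_0)$ lies in a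 relation $R$ such that for every $(s,t)\in R$ and every $M\in\mathrm{Tran}(s)$ there is $N\in\mathrm{Tran}(t)$ with: every $(a,s')\in M$ has some $(a,t')\in N$ with $(s',t')\in R$, and every $(a,t')\in N$ has some $(a,s')\in M$ with $(s',t')\in R$. Modal refinement of PMTS states $s_0\in S_1,t_0\in S_2$: $s_0\le_m t_0$ iff for every $\mu\subseteq P_1$ there exists $\nu\subseteq P_2$ such that $s_0^\mu\le_m t_0^\nu$. *)

(* Defs.v *)
From mathcomp Require Import all_boot finmap.

Set Implicit Arguments.
Unset Strict Implicit.
Unset Printing Implicit Defensive.

Local Open Scope fset_scope.

Inductive form (X : Type) : Type :=
  | Tt
  | Atom of X
  | Neg of form X
  | And of form X & form X
  | Or of form X & form X.

Arguments Tt {X}.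

Definition Ff {X : Type} : form X := Neg Tt.

Definition Imp {X : Type} (f g : form X) : form X := Or (Neg f) g.

Fixpoint sat (X : Type) (nu : pred X) (f : form X) : bool :=
  match f with
  | Tt => true
  | Atom x => nu x
  | Neg g => ~~ sat nu g
  | And g h => sat nu g && sat nu h
  | Or g h => sat nu g || sat nu h
  end.

Fixpoint atoms (X : Type) (f : form X) : seq X :=
  match f with
  | Tt => [::]
  | Atom x => [:: x]
  | Neg g => atoms g
  | And g h | Or g h => atoms g ++ atoms h
  end.

Fixpoint subst (X Y : Type) (r : X -> form Y) (f : form X) : form Y :=
  match f with
  | Tt => Tt
  | Atom x => r x
  | Neg g => Neg (subst r g)
  | And g h => And (subst r g) (subst r h)
  | Or g h => Or (subst r g) (subst r h)
  end.

(* Finite PMTS: the states form a finite type and the transitions a finite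
   set; the alphabet Sigma itself may be infinite.  The atoms (Sigma * S) and
   the parameters P are kept apart by the sum type. *)
Record pmts (Sigma : choiceType) (S P : finType) : Type := Pmts {
  trans : {fset S * Sigma * S};
  obl : S -> form (Sigma * S + P);
  obl_trans : forall (s : S) (a : Sigma) (t : S),
    inl (a, t) \in atoms (obl s) -> (s, a, t) \in trans
}.

Definition bmts (Sigma : choiceType) (S : finType) : Type := pmts Sigma S void.

Definition succs (Sigma : choiceType) (S P : finType) (M : pmts Sigma S P)
    (s : S) : {fset Sigma * S} :=
  [fset (e.1.2, e.2) | e in trans M & e.1.1 == s].

Definition tran_val (Sigma : choiceType) (S : finType) (E : {fset Sigma * S}) :
    pred (Sigma * S + void) :=
  fun x => match x with inl e => e \in E | inr p => match p with end end.

Definition tran (Sigma : choiceType) (S : finType) (M : bmts Sigma S) (s : S) :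
    {fset {fset Sigma * S}} :=
  [fset E in fpowerset (succs M s) | sat (tran_val E) (obl M s)].

Definition inst_atom (A : Type) (P : finType) (nu : {set P}) (x : A + P) :
    form (A + void) :=
  match x with
  | inl e => Atom (inl e)
  | inr p => if p \in nu then Tt else Ff
  end.

Lemma atoms_inst (A : eqType) (P : finType) (nu : {set P})
    (f : form (A + P)) (e : A) :
  inl e \in atoms (subst (inst_atom nu) f) -> inl e \in atoms f.
Proof.
elim: f => [|x|g IHg|g IHg h IHh|g IHg h IHh] //=.
- by case: x => [e'|p] //=; case: (p \in nu).
- by rewrite !mem_cat => /orP[/IHg ->|/IHh ->]; rewrite ?orbT.
- by rewrite !mem_cat => /orP[/IHg ->|/IHh ->]; rewrite ?orbT.
Qed.

Lemma inst_trans (Sigma : choiceType) (S P : finType) (M : pmts Sigma S P)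
    (nu : {set P}) (s : S) (a : Sigma) (t : S) :
  inl (a, t) \in atoms (subst (inst_atom nu) (obl M s)) ->
  (s, a, t) \in trans M.
Proof. by move=> /atoms_inst /obl_trans. Qed.

Definition inst (Sigma : choiceType) (S P : finType) (M : pmts Sigma S P)
    (nu : {set P}) : bmts Sigma S :=
  @Pmts Sigma S void (trans M) (fun s => subst (inst_atom nu) (obl M s))
    (@inst_trans Sigma S P M nu).

Definition modal_refinement (Sigma : choiceType) (S1 S2 : finType)
    (B1 : bmts Sigma S1) (B2 : bmts Sigma S2) (R : {set S1 * S2}) : Prop :=
  forall (s : S1) (t : S2), (s, t) \in R ->
  forall M : {fset Sigma * S1}, M \in tran B1 s ->
  exists N : {fset Sigma * S2},
    [/\ N \in tran B2 t,
        forall (a : Sigma) (s' : S1), (a, s') \in M ->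
          exists t' : S2, (a, t') \in N /\ (s', t') \in R
      & forall (a : Sigma) (t' : S2), (a, t') \in N ->
          exists s' : S1, (a, s') \in M /\ (s', t') \in R].

Definition bmts_refines (Sigma : choiceType) (S1 S2 : finType)
    (B1 : bmts Sigma S1) (s0 : S1) (B2 : bmts Sigma S2) (t0 : S2) : Prop :=
  exists R : {set S1 * S2}, modal_refinement B1 B2 R /\ (s0, t0) \in R.

Definition pmts_refines (Sigma : choiceType) (S1 P1 S2 P2 : finType)
    (M1 : pmts Sigma S1 P1) (s0 : S1) (M2 : pmts Sigma S2 P2) (t0 : S2) :
    Prop :=
  forall mu : {set P1}, exists nu : {set P2},
    bmts_refines (inst M1 mu) s0 (inst M2 nu) t0.

Inductive qbf (X : Type) : Type :=
  | Matrix of form X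
  | Forall of pred X & qbf X
  | Exists of pred X & qbf X.

Definition reassign (X : Type) (B nu nu' : pred X) : Prop :=
  forall x : X, ~~ B x -> nu' x = nu x.

Fixpoint qsat (X : Type) (nu : pred X) (q : qbf X) : Prop :=
  match q with
  | Matrix f => sat nu f
  | Forall B q' => forall nu' : pred X, reassign B nu nu' -> qsat nu' q'
  | Exists B q' => exists nu' : pred X, reassign B nu nu' /\ qsat nu' q'
  end.

(* Meant for closed formulae, on which the initial valuation is irrelevant. *)
Definition qtrue (X : Type) (q : qbf X) : Prop := qsat pred0 q.

(* XT1 and XT2 range over all triples; the atoms actually used, i.e. those
   whose triple is a transition, are carved out by in_XT1 and in_XT2. *)
Inductive ap (Sigma S1 P1 S2 P2 : Type) : Type :=
  | XR of S1 * S2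
  | XT1 of S1 * Sigma * S1
  | XT2 of S1 & S2 * Sigma * S2
  | Par1 of P1
  | Par2 of P2.

Arguments XR {Sigma S1 P1 S2 P2}.
Arguments XT1 {Sigma S1 P1 S2 P2}.
Arguments XT2 {Sigma S1 P1 S2 P2}.
Arguments Par1 {Sigma S1 P1 S2 P2}.
Arguments Par2 {Sigma S1 P1 S2 P2}.

Definition in_XR {Sigma S1 P1 S2 P2 : Type} : pred (ap Sigma S1 P1 S2 P2) :=
  fun x => if x is XR _ then true else false.

Definition in_XT1 (Sigma : choiceType) (S1 P1 S2 P2 : finType)
    (M1 : pmts Sigma S1 P1) : pred (ap Sigma S1 P1 S2 P2) :=
  fun x => if x is XT1 e then e \in trans M1 else false.

Definition in_XT2 (Sigma : choiceType) (S1 P1 S2 P2 : finType)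
    (M2 : pmts Sigma S2 P2) : pred (ap Sigma S1 P1 S2 P2) :=
  fun x => if x is XT2 _ e then e \in trans M2 else false.

Definition in_P1 {Sigma S1 P1 S2 P2 : Type} : pred (ap Sigma S1 P1 S2 P2) :=
  fun x => if x is Par1 _ then true else false.

Definition in_P2 {Sigma S1 P1 S2 P2 : Type} : pred (ap Sigma S1 P1 S2 P2) :=
  fun x => if x is Par2 _ then true else false.

Definition pi1 {Sigma S1 P1 S2 P2 : Type} (u : S1) :
    form (Sigma * S1 + P1) -> form (ap Sigma S1 P1 S2 P2) :=
  subst (fun x => match x with
                  | inl (a, u') => Atom (XT1 (u, a, u'))
                  | inr p => Atom (Par1 p)
                  end).

Definition pi2 {Sigma S1 P1 S2 P2 : Type} (u : S1) (v : S2) :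
    form (Sigma * S2 + P2) -> form (ap Sigma S1 P1 S2 P2) :=
  subst (fun x => match x with
                  | inl (a, v') => Atom (XT2 u (v, a, v'))
                  | inr p => Atom (Par2 p)
                  end).

(* In the big operators a transition e is a triple (source, action, target)
   with source e.1.1, action e.1.2 and target e.2. *)
Definition phi (Sigma : choiceType) (S1 P1 S2 P2 : finType)
    (M1 : pmts Sigma S1 P1) (M2 : pmts Sigma S2 P2) (u : S1) (v : S2) :
    form (ap Sigma S1 P1 S2 P2) :=
  And
    (\big[@And _/Tt]_(e <- trans M1 | e.1.1 == u)
       Imp (Atom (XT1 e))
         (\big[@Or _/Ff]_(f <- trans M2 | (f.1.1 == v) && (f.1.2 == e.1.2))
            And (Atom (XT2 u f)) (Atom (XR (e.2, f.2)))))
    (\big[@And _/Tt]_(f <- trans M2 | f.1.1 == v)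
       Imp (Atom (XT2 u f))
         (\big[@Or _/Ff]_(e <- trans M1 | (e.1.1 == u) && (e.1.2 == f.1.2))
            And (Atom (XT1 e)) (Atom (XR (e.2, f.2))))).

Definition psi (Sigma : choiceType) (S1 P1 S2 P2 : finType)
    (M1 : pmts Sigma S1 P1) (M2 : pmts Sigma S2 P2) (u : S1) (v : S2) :
    form (ap Sigma S1 P1 S2 P2) :=
  Imp (pi1 u (obl M1 u)) (And (pi2 u v (obl M2 v)) (phi M1 M2 u v)).

Definition Psi (Sigma : choiceType) (S1 P1 S2 P2 : finType)
    (M1 : pmts Sigma S1 P1) (M2 : pmts Sigma S2 P2) (s : S1) (t : S2) :
    form (ap Sigma S1 P1 S2 P2) :=
  And (Atom (XR (s, t)))
    (\big[@And _/Tt]_(w : S1 * S2) Imp (Atom (XR w)) (psi M1 M2 w.1 w.2)).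

Definition refinement_qbf (Sigma : choiceType) (S1 P1 S2 P2 : finType)
    (M1 : pmts Sigma S1 P1) (M2 : pmts Sigma S2 P2) (s : S1) (t : S2) :
    qbf (ap Sigma S1 P1 S2 P2) :=
  Forall in_P1 (Exists in_P2 (Exists in_XR
    (Forall (in_XT1 M1) (Exists (in_XT2 M2) (Matrix (Psi M1 M2 s t)))))).

(* Main.v *)
Require Import Defs.
From mathcomp Require Import all_boot finmap.

Set Implicit Arguments.
Unset Strict Implicit.
Unset Printing Implicit Defensive.

Local Open Scope fset_scope.

(** A valuation of [X_T1] picks a set of successors [M u] for every [u] at once,
and a valuation of [X_T2] picks an answer [N u v] for every pair [(u, v)].
Since [psi u v] only looks at [M u] and [N u v], the quantifier block
[forall X_T1, exists X_T2] over all pairs is equivalent to the pairwise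
condition "for all [M] there is [N]" of modal refinement: in one direction the
answers are collected by finite choice, in the other a single [M] is extended
to a valuation. *)

Lemma eq_sat (X : Type) (nu nu' : pred X) (f : form X) :
  nu =1 nu' -> sat nu f = sat nu' f.
Proof. by move=> e; elim: f => //= [g ->|g -> h ->|g -> h ->]. Qed.

Lemma sat_subst (X Y : Type) (nu : pred Y) (r : X -> form Y) (f : form X) :
  sat nu (subst r f) = sat (fun x => sat nu (r x)) f.
Proof. by elim: f => //= [g ->|g -> h ->|g -> h ->]. Qed.

Lemma sat_bigAndP (X : Type) (I : eqType) (nu : pred X) (r : seq I)
    (P : pred I) (F : I -> form X) :
  reflect (forall i, i \in r -> P i -> sat nu (F i))
          (sat nu (\big[@And _/Tt]_(i <- r | P i) F i)).
Proof.
rewrite (big_morph (sat nu) (id1 := true) (op1 := andb)) // big_all_cond.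
by apply: (iffP allP) => H i /H /implyP.
Qed.

Lemma sat_bigOrP (X : Type) (I : eqType) (nu : pred X) (r : seq I)
    (P : pred I) (F : I -> form X) :
  reflect (exists2 i, i \in r & P i && sat nu (F i))
          (sat nu (\big[@Or _/Ff]_(i <- r | P i) F i)).
Proof.
rewrite (big_morph (sat nu) (id1 := false) (op1 := orb)) // big_has_cond.
exact: hasP.
Qed.

Lemma mem_succs (Sigma : choiceType) (S P : finType) (M : pmts Sigma S P)
    (s : S) (a : Sigma) (t : S) :
  ((a, t) \in succs M s) = ((s, a, t) \in trans M).
Proof.
apply/imfsetP/idP => [[[[s' b] t'] /=]|ste].
  by rewrite !inE /= => /andP[ste /eqP <-] [-> ->].
by exists (s, a, t); rewrite //= !inE /= ste eqxx.
Qed.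

(** Both sides evaluate [obl M s] with each action atom read off from [E] and each parameter from
    [mu]. Keeping [r] arbitrary covers the renamings [pi1 u] and [pi2 u v] at once. *)
Lemma mem_tran_inst (Sigma : choiceType) (S P : finType) (M : pmts Sigma S P)
    (mu : {set P}) (s : S) (X : Type) (nu : pred X)
    (r : Sigma * S + P -> form X) (E : {fset Sigma * S}) :
  (forall e, sat nu (r (inl e)) = (e \in E)) ->
  (forall p, sat nu (r (inr p)) = (p \in mu)) ->
  E `<=` succs M s ->
  (E \in tran (inst M mu) s) = sat nu (subst r (obl M s)).
Proof.
move=> rl rr sE; have sE' : E `<=` succs (inst M mu) s.
  by apply/fsubsetP => -[a t] /(fsubsetP sE); rewrite !mem_succs.
rewrite /tran !inE fpowersetE sE' /= !sat_subst; apply: eq_sat => -[e|p] /=.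
  by rewrite rl.
by rewrite rr; case: (p \in mu).
Qed.

Lemma tran_inst_sub (Sigma : choiceType) (S P : finType) (M : pmts Sigma S P)
    (mu : {set P}) (s : S) (E : {fset Sigma * S}) :
  E \in tran (inst M mu) s -> E `<=` succs M s.
Proof.
rewrite !inE fpowersetE => /andP[/fsubsetP sE _].
by apply/fsubsetP => -[a t] /sE; rewrite !mem_succs.
Qed.

Definition matching (Sigma : choiceType) (S1 S2 : finType) (R : {set S1 * S2})
    (M : {fset Sigma * S1}) (N : {fset Sigma * S2}) : Prop :=
  (forall (a : Sigma) (s' : S1), (a, s') \in M ->
     exists t' : S2, (a, t') \in N /\ (s', t') \in R) /\
  (forall (a : Sigma) (t' : S2), (a, t') \in N ->
     exists s' : S1, (a, s') \in M /\ (s', t') \in R).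

(** The big operators of [phi] range over transitions only. Containment in the successor sets thus
    ensures that every element of [M] or [N] is constrained by a conjunct and is available as a
    disjunct. *)
Lemma sat_phi (Sigma : choiceType) (S1 P1 S2 P2 : finType)
    (M1 : pmts Sigma S1 P1) (M2 : pmts Sigma S2 P2) (u : S1) (v : S2)
    (nu : pred (ap Sigma S1 P1 S2 P2)) (R : {set S1 * S2})
    (M : {fset Sigma * S1}) (N : {fset Sigma * S2}) :
  (forall w, nu (XR w) = (w \in R)) ->
  (forall a u', nu (XT1 (u, a, u')) = ((a, u') \in M)) ->
  (forall a v', nu (XT2 u (v, a, v')) = ((a, v') \in N)) ->
  M `<=` succs M1 u -> N `<=` succs M2 v ->
  sat nu (phi M1 M2 u v) <-> matching R M N.
Proof.
move=> nuR nuM nuN /fsubsetP sM /fsubsetP sN; split.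
  move=> /= /andP[/sat_bigAndP H1 /sat_bigAndP H2]; split.
    move=> a u' Mu'; have /= := H1 (u, a, u').
    rewrite -mem_succs sM // eqxx nuM Mu' => /(_ isT isT) /sat_bigOrP[].
    move=> [[v0 b] v'] _ /= /andP[/andP[/eqP-> /eqP->]].
    by rewrite nuN nuR => /andP[]; exists v'.
  move=> a v' Nv'; have /= := H2 (v, a, v').
  rewrite -mem_succs sN // eqxx nuN Nv' => /(_ isT isT) /sat_bigOrP[].
  move=> [[u0 b] u'] _ /= /andP[/andP[/eqP-> /eqP->]].
  by rewrite nuM nuR => /andP[]; exists u'.
move=> [H1 H2] /=; apply/andP; split; apply/sat_bigAndP.
  move=> [[u0 a] u'] _ /= /eqP->; rewrite nuM -implybE.
  apply/implyP => /H1[v' [Nv' Rv']]; apply/sat_bigOrP.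
  by exists (v, a, v'); rewrite -?mem_succs ?sN //= !eqxx nuN nuR Nv'.
move=> [[v0 a] v'] _ /= /eqP->; rewrite nuN -implybE.
apply/implyP => /H2[u' [Mu' Ru']]; apply/sat_bigOrP.
by exists (u, a, u'); rewrite -?mem_succs ?sM //= !eqxx nuM nuR Mu'.
Qed.

Lemma sat_psi (Sigma : choiceType) (S1 P1 S2 P2 : finType)
    (M1 : pmts Sigma S1 P1) (M2 : pmts Sigma S2 P2) (u : S1) (v : S2)
    (nu : pred (ap Sigma S1 P1 S2 P2)) (mu1 : {set P1}) (mu2 : {set P2})
    (R : {set S1 * S2}) (M : {fset Sigma * S1}) (N : {fset Sigma * S2}) :
  (forall p, nu (Par1 p) = (p \in mu1)) ->
  (forall p, nu (Par2 p) = (p \in mu2)) ->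
  (forall w, nu (XR w) = (w \in R)) ->
  (forall a u', nu (XT1 (u, a, u')) = ((a, u') \in M)) ->
  (forall a v', nu (XT2 u (v, a, v')) = ((a, v') \in N)) ->
  M `<=` succs M1 u -> N `<=` succs M2 v ->
  sat nu (psi M1 M2 u v) <->
  (M \in tran (inst M1 mu1) u ->
   N \in tran (inst M2 mu2) v /\ matching R M N).
Proof.
move=> nu1 nu2 nuR nuM nuN sM sN /=.
rewrite -(mem_tran_inst (mu := mu1) (E := M)) //; last by case.
rewrite -(mem_tran_inst (mu := mu2) (E := N)) //; last by case.
have phiP := sat_phi nuR nuM nuN sM sN.
rewrite -implybE; split.
  by move=> /implyP H /H /andP[-> /phiP].
by move=> H; apply/implyP => /H[-> /phiP].
Qed.

Lemma sat_Psi (Sigma : choiceType) (S1 P1 S2 P2 : finType)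
    (M1 : pmts Sigma S1 P1) (M2 : pmts Sigma S2 P2) (s : S1) (t : S2)
    (nu : pred (ap Sigma S1 P1 S2 P2)) :
  sat nu (Psi M1 M2 s t) <->
  nu (XR (s, t)) /\ forall u v, nu (XR (u, v)) -> sat nu (psi M1 M2 u v).
Proof.
split=> [/andP[st /sat_bigAndP H]|[st H]].
  split=> // u v uv; have := H (u, v) (mem_index_enum _) isT.
  by rewrite -[sat _ _]/(~~ nu (XR (u, v)) || sat nu (psi M1 M2 u v)) uv.
apply/andP; split=> //; apply/sat_bigAndP => -[u v] _ _.
rewrite -[sat _ _]/(~~ nu (XR (u, v)) || sat nu (psi M1 M2 u v)) -implybE.
by apply/implyP/H.
Qed.

(** Filtering the finite set of successors yields a finite set even when [Sigma] is infinite.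
    Nothing is lost when [nu] is false on triples that are not transitions. *)
Definition row1 (Sigma : choiceType) (S1 P1 S2 P2 : finType)
    (M1 : pmts Sigma S1 P1) (nu : pred (ap Sigma S1 P1 S2 P2)) (u : S1) :
    {fset Sigma * S1} :=
  [fset x in succs M1 u | nu (XT1 (u, x.1, x.2))].

Definition row2 (Sigma : choiceType) (S1 P1 S2 P2 : finType)
    (M2 : pmts Sigma S2 P2) (nu : pred (ap Sigma S1 P1 S2 P2)) (u : S1)
    (v : S2) : {fset Sigma * S2} :=
  [fset x in succs M2 v | nu (XT2 u (v, x.1, x.2))].

Lemma mem_row1 (Sigma : choiceType) (S1 P1 S2 P2 : finType)
    (M1 : pmts Sigma S1 P1) (nu : pred (ap Sigma S1 P1 S2 P2)) (u : S1) :
  (forall e, nu (XT1 e) -> e \in trans M1) ->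
  forall a u', nu (XT1 (u, a, u')) = ((a, u') \in row1 M1 nu u).
Proof.
move=> sup a u'; rewrite !inE mem_succs /= andbC.
by case: (boolP (nu _)) => // /sup.
Qed.

Lemma mem_row2 (Sigma : choiceType) (S1 P1 S2 P2 : finType)
    (M2 : pmts Sigma S2 P2) (nu : pred (ap Sigma S1 P1 S2 P2)) (u : S1)
    (v : S2) :
  (forall e, nu (XT2 u e) -> e \in trans M2) ->
  forall a v', nu (XT2 u (v, a, v')) = ((a, v') \in row2 M2 nu u v).
Proof.
move=> sup a v'; rewrite !inE mem_succs /= andbC.
by case: (boolP (nu _)) => // /sup.
Qed.

Lemma refines_qtrue (Sigma : choiceType) (S1 P1 S2 P2 : finType)
    (M1 : pmts Sigma S1 P1) (M2 : pmts Sigma S2 P2) (s : S1) (t : S2) :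
  pmts_refines M1 s M2 t -> qtrue (refinement_qbf M1 M2 s t).
Proof.
move=> ref nu1 /= re1; have [mu2 [R [Rref Rst]]] := ref [set p | nu1 (Par1 p)].
pose nu2 x := if x is Par2 p then p \in mu2 else nu1 x.
exists nu2; split; first by case.
pose nu3 x := if x is XR w then w \in R else nu2 x.
exists nu3; split; first by case.
(* No block quantifies over an [XT1] atom outside [trans M1], so such an atom keeps its initial
   value, false. *)
move=> nu4 re4; have sup4 e : nu4 (XT1 e) -> e \in trans M1.
  by apply: contraTT => Ne; rewrite re4 //= re1.
(* The conditions on [w] sit inside [good] as premises, so that an answer exists for every pair and
   finite choice applies. Where a premise fails, the empty set serves. *)
pose good w (N : {fset Sigma * S2}) := N `<=` succs M2 w.2 /\
  (w \in R -> row1 M1 nu4 w.1 \in tran (inst M1 [set p | nu1 (Par1 p)]) w.1 ->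
   N \in tran (inst M2 mu2) w.2 /\ matching R (row1 M1 nu4 w.1) N).
have /fin_all_exists[N Ngood] : forall w, exists N, good w N.
  move=> [u v]; case: (boolP (row1 M1 nu4 u \in
      tran (inst M1 [set p | nu1 (Par1 p)]) u)) => [Mtr|Mtr]; last first.
    by exists fset0; split=> //= _; rewrite (negPf Mtr).
  case: (boolP ((u, v) \in R)) => [uv|uv]; last first.
    by exists fset0; split=> //=; rewrite (negPf uv).
  have [N [Ntr H1 H2]] := Rref _ _ uv _ Mtr.
  by exists N; split=> //=; apply: tran_inst_sub Ntr.
pose nu5 x := if x is XT2 u (v, a, v') then (a, v') \in N (u, v) else nu4 x.
exists nu5; split.
  (* Off the transitions of [M2] both valuations must be false: [nu4] by inheritance from the
     initial one, [nu5] because [N (u, v)] consists of successors of [v]. *)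
  case=> // u [[v a] v'] /= Ne; rewrite [RHS]re4 //= re1 //=.
  apply: contraNF Ne => /(fsubsetP (Ngood (u, v)).1).
  by rewrite mem_succs.
have nuR w : nu5 (XR w) = (w \in R) by rewrite /= re4.
apply/sat_Psi; split=> [|u v]; rewrite nuR // => uv.
have [sN Nuv] := Ngood (u, v).
apply/(@sat_psi _ _ _ _ _ M1 M2 u v nu5 [set p | nu1 (Par1 p)] mu2 R
         (row1 M1 nu4 u) (N (u, v))) => //.
- by move=> p; rewrite /= re4 //= inE.
- by move=> p; rewrite /= re4.
- exact: mem_row1.
- exact: fset_sub.
- exact: Nuv.
Qed.

Lemma qtrue_refines (Sigma : choiceType) (S1 P1 S2 P2 : finType)
    (M1 : pmts Sigma S1 P1) (M2 : pmts Sigma S2 P2) (s : S1) (t : S2) :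
  qtrue (refinement_qbf M1 M2 s t) -> pmts_refines M1 s M2 t.
Proof.
move=> qt mu1.
(* Outside [P1] this valuation must agree with the initial one, which is everywhere false. *)
have /= := qt (fun x => if x is Par1 p then p \in mu1 else false).
case=> [|nu2 [re2 [nu3 [re3 qt3]]]]; first by case.
exists [set p | nu2 (Par2 p)], [set w | nu3 (XR w)]; split; last first.
  (* Any choice for the universal block gives the root pair, as the later blocks leave the [XR]
     atoms unchanged; [nu3] itself will do. *)
  have [nu4 _|nu5 [re5 /sat_Psi[]]] := qt3 nu3; first by [].
  by rewrite inE re5.
move=> u v; rewrite inE => uv M Mtr; have sM := tran_inst_sub Mtr.
(* The given [M] fills the row of [u], and all other rows are left empty, since [psi M1 M2 u v]
   reads only the row of [u]. *)
pose nu4 x := if x is XT1 (u', a, u'') then (u' == u) && ((a, u'') \in M)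
              else nu3 x.
have [|nu5 [re5 /sat_Psi[_ H]]] := qt3 nu4.
  case=> // -[[u' a] u''] /= Ne; rewrite re3 // re2 //.
  apply: contraNF Ne => /andP[/eqP-> /(fsubsetP sM)].
  by rewrite mem_succs.
have sup5 e : nu5 (XT2 u e) -> e \in trans M2.
  by apply: contraTT => Ne; rewrite re5 //= re3 // re2.
have := H u v; rewrite re5 // => /(_ uv).
move/(@sat_psi _ _ _ _ _ M1 M2 u v nu5 mu1 [set p | nu2 (Par2 p)]
        [set w | nu3 (XR w)] M (row2 M2 nu5 u v)).
case=> //.
- by move=> p; rewrite re5 //= re3 // re2.
- by move=> p; rewrite re5 //= re3 // inE.
- by move=> w; rewrite re5 //= inE.
- by move=> a u'; rewrite re5 //= eqxx.
- exact: mem_row2.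
- exact: fset_sub.
(* The answer to [M] is read off from the [XT2] atoms at [(u, v)] in the valuation provided by the
   innermost block. *)
by move=> Ntr [H1 H2]; exists (row2 M2 nu5 u v).
Qed.

Theorem theorem2 (Sigma : choiceType) (S1 P1 S2 P2 : finType)
    (M1 : pmts Sigma S1 P1) (M2 : pmts Sigma S2 P2) (s : S1) (t : S2) :
  pmts_refines M1 s M2 t <-> qtrue (refinement_qbf M1 M2 s t).
Proof. by split; [apply: refines_qtrue | apply: qtrue_refines]. Qed.
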